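(* If a rectangular dualizable graph $\mathcal{G}=(V,E)$ is edge-reducible to a rectangular dualizable graph $\mathcal{G}'=(V,E')$ such that $E=E'\cup\{(v_i,v_j)\}$ (with $(v_i,v_j)\notin E'$), then $(v_i,v_j)$ is an exterior edge of $\mathcal{G}$.
   Context: All graphs considered are connected plane graphs whose interior faces (regions) are all triangles. A planar graph is a rectangular dualizable graph (RDG) if its dual graph can be realized as a rectangular floorplan (a partition of a rectangle into rectangles such that no four of them meet at a point); equivalently its dual is a plane graph whose edges can be oriented horizontally or vertically, with four-sided internal regions and a rectangular enclosure. An RDG $\mathcal{G}=(V,E)$ is edge-reducible if there exists an RDG $\mathcal{G}'=(V,E')$ with $E\supset E'$. An exterior edge is an edge lying on the exterior (unbounded) face. *)

(* Defs.v *)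
From HB Require Import structures.
From mathcomp Require Import all_boot all_order all_algebra all_fingroup.
From mathcomp Require Import reals.

Set Implicit Arguments.
Unset Strict Implicit.
Unset Printing Implicit Defensive.

Import Order.TTheory GRing.Theory Num.Theory.
Local Open Scope ring_scope.

(* A graph (V, E) drawn in the plane, given as a combinatorial map:
   [rotation u] is the clockwise cyclic order of the neighbours of [u], and
   [outer] is the exterior face.  The edge {u, v} carries the darts (u, v) and
   (v, u); a face is identified with the set of darts that have it on their
   left. *)
Record plane_graph (V : finType) := PlaneGraph {
  edges : {set {set V}};
  rotation : V -> {perm V};
  outer : {set V * V}
}.

Section PlaneGraphs.
Variable V : finType.
Implicit Type G : plane_graph V.

Definition adj G (u v : V) : bool := [set u; v] \in edges G.

Definition darts G : {set V * V} := [set x | adj G x.1 x.2].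

Definition simple_graph G : Prop := forall e, e \in edges G -> (#|e| = 2)%N.

Definition connected_graph G : Prop := forall u v, connect (adj G) u v.

Definition rotation_system G : Prop :=
  forall u, perm_on [set v | adj G u v] (rotation G u) /\
    (forall v w, adj G u v -> adj G u w -> w \in porbit (rotation G u) v).

Definition face_next G (x : V * V) : V * V := (x.2, rotation G x.2 x.1).

Definition face_of G (x : V * V) : {set V * V} :=
  [set y | fconnect (face_next G) x y].

(* The one-vertex graph has no dart, but still has one (exterior) face. *)
Definition faces G : {set {set V * V}} :=
  if darts G == set0 then [set set0] else [set face_of G x | x in darts G].

(* Euler's formula says that the connected map has genus 0, i.e. that it is
   a map of the plane. *)
Definition connected_plane G : Prop :=
  [/\ simple_graph G, rotation_system G, connected_graph G,
      outer G \in faces G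
    & (#|V| + #|faces G| = #|edges G| + 2)%N].

Definition interior_triangulated G : Prop :=
  forall f, f \in faces G -> f != outer G -> (#|f| = 3)%N.

Definition exterior_edge G (u v : V) : bool :=
  adj G u v && (((u, v) \in outer G) || ((v, u) \in outer G)).

End PlaneGraphs.

Record rect (R : realType) := Rect {
  xmin : R; xmax : R; ymin : R; ymax : R;
  rect_width : xmin < xmax;
  rect_height : ymin < ymax
}.

Section Floorplans.
Variable R : realType.
Implicit Types (B : rect R) (p q z : R * R).

Definition in_rect B z : bool :=
  (xmin B <= z.1 <= xmax B) && (ymin B <= z.2 <= ymax B).

Definition in_interior B z : bool :=
  (xmin B < z.1 < xmax B) && (ymin B < z.2 < ymax B).

Definition on_boundary B z : bool := in_rect B z && ~~ in_interior B z.

Definition in_segment p q z : Prop :=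
  exists2 t : R, 0 <= t <= 1
    & z = (p.1 + t * (q.1 - p.1), p.2 + t * (q.2 - p.2)).

Definition rectangular_floorplan (V : finType) B (r : V -> rect R) : Prop :=
  [/\ forall z, in_rect B z <-> exists v, in_rect (r v) z,
      forall u v z, u != v -> ~~ (in_interior (r u) z && in_interior (r v) z)
    & forall z, (#|[set v | in_rect (r v) z]| <= 3)%N].

(* The floorplan [r] with enclosure [B] is the dual of [G].  The region of [v]
   is [r v], and the dual edge of {u, v} is the wall shared by [r u] and [r v];
   it joins [pos (u, v)] to [pos (v, u)], the positions of the faces on the two
   sides of {u, v}.  An interior face sits at a single point; the exterior
   face is spread over the boundary of the enclosure, so that [pos] varies
   among its darts. *)
Definition realizes_dual (V : finType) (G : plane_graph V) B
    (r : V -> rect R) : Prop :=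
  exists pos : V * V -> R * R,
  [/\ forall x y, x \in darts G -> x \notin outer G ->
        y \in face_of G x -> pos x = pos y,
      forall x, x \in outer G -> on_boundary B (pos x),
      forall u v, adj G u v ->
        pos (u, v) != pos (v, u) /\
        (forall z, in_rect (r u) z && in_rect (r v) z <->
                   in_segment (pos (u, v)) (pos (v, u)) z)
    & forall u v, u != v -> ~~ adj G u v ->
        forall p q, p != q ->
        ~ (forall z, in_segment p q z -> in_rect (r u) z && in_rect (r v) z)].

End Floorplans.

Definition RDG (R : realType) (V : finType) (G : plane_graph V) : Prop :=
  [/\ connected_plane G, interior_triangulated G
    & exists (B : rect R) (r : V -> rect R),
        rectangular_floorplan B r /\ realizes_dual G B r].

(* Only the edge sets are compared: the drawing of [G'] need not be the one
   inherited from [G]. *)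
Definition edge_reducible_to (R : realType) (V : finType)
    (G G' : plane_graph V) : Prop :=
  [/\ RDG R G, RDG R G' & edges G' \proper edges G].

(* Main.v *)
(* In an RDG the 3-cliques correspond to the interior faces.  Distinct interior
   faces have distinct vertex sets; conversely, three pairwise adjacent
   rectangles share a point, which is the position of an interior face.  By
   Euler's formula, deleting one edge lowers the number of interior faces by
   one, so the deleted edge lies in exactly one 3-clique.  An edge that is not
   exterior lies on two interior faces, hence in two 3-cliques. *)

Require Import Defs.
From mathcomp Require Import all_boot all_order all_algebra all_fingroup.
From mathcomp Require Import reals lra.

Set Implicit Arguments.
Unset Strict Implicit.
Unset Printing Implicit Defensive.

Import Order.TTheory GRing.Theory Num.Theory.

(** * Faces, 3-cliques and Euler's formula in a combinatorial plane graph *)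

Section PlaneGraphTheory.
Variable V : finType.
Implicit Types (G : plane_graph V) (u v a b c : V) (x y : V * V).
Implicit Type f : {set V * V}.

Definition interior_faces G : {set {set V * V}} := faces G :\ outer G.

Definition face_vertices f : {set V} := [set x.1 | x in f].

(** Unordered vertex sets rather than faces: they depend on [edges G] alone, so graphs drawn
    differently can be compared. *)
Definition triangles G : {set {set V}} :=
  [set [set t.1.1; t.1.2; t.2] | t : V * V * V &
    [&& adj G t.1.1 t.1.2, adj G t.1.2 t.2 & adj G t.2 t.1.1]].

Lemma trianglesP G (t : {set V}) :
  reflect (exists a b c,
             [/\ adj G a b, adj G b c, adj G c a & t = [set a; b; c]])
          (t \in triangles G).
Proof.
apply: (iffP imsetP) => [[[[a b] c] /=]|[a [b [c [ab bc ca ->]]]]].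
  by rewrite inE => /and3P[/= ab bc ca] ->; exists a, b, c.
by exists (a, b, c) => //; rewrite inE /= ab bc ca.
Qed.

Lemma adjC G u v : adj G u v = adj G v u.
Proof. by rewrite /adj setUC. Qed.

Lemma adj_neq G u v : simple_graph G -> adj G u v -> u != v.
Proof. by move=> sG /sG; rewrite cards2; case: eqP. Qed.

Lemma triangle_adj G t u v : t \in triangles G ->
  u \in t -> v \in t -> u != v -> adj G u v.
Proof.
case/trianglesP => [a [b [c [ab bc ca ->]]]]; rewrite !inE -!orbA.
by case/or3P=> /eqP-> /or3P[] /eqP->; rewrite ?eqxx // adjC.
Qed.

Lemma mem_darts G u v : ((u, v) \in darts G) = adj G u v.
Proof. by rewrite inE. Qed.

Lemma face_next_inj G : injective (face_next G).
Proof. by case=> [a b] [c d] [-> /perm_inj ->]. Qed.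

Lemma face_of_refl G x : x \in face_of G x.
Proof. by rewrite inE connect0. Qed.

Lemma face_of_eq G x y : y \in face_of G x -> face_of G y = face_of G x.
Proof.
rewrite inE => xy; apply/setP => z; rewrite !inE.
by rewrite (same_connect (fconnect_sym (@face_next_inj G)) xy).
Qed.

Lemma rotation_adj G u v :
  rotation_system G -> adj G u v -> adj G u (rotation G u v).
Proof.
by move=> /(_ u)[rG _]; have := perm_closed v rG; rewrite !inE => ->.
Qed.

Lemma faces_face_of G f x : f \in faces G -> x \in f -> f = face_of G x.
Proof.
rewrite /faces; case: ifP => _ => [|/imsetP[y _ ->] /face_of_eq //].
by rewrite inE => /eqP->; rewrite inE.
Qed.

Lemma face_of_interior G x : outer G \in faces G -> x \in darts G ->
  (face_of G x \in interior_faces G) = (x \notin outer G).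
Proof.
move=> oG xG; rewrite !inE andbC /faces ifF; last first.
  by apply/eqP => d0; rewrite d0 inE in xG.
rewrite imset_f //=; congr (~~ _); apply/eqP/idP => [<-|].
  exact: face_of_refl.
by move/(faces_face_of oG).
Qed.

Lemma interior_faceP G f : outer G \in faces G ->
  f \in interior_faces G -> exists2 x, x \in darts G & f = face_of G x.
Proof.
move=> oG; rewrite !inE => /andP[fo]; move: oG; rewrite /faces.
case: ifP => _; last by move=> _ /imsetP.
by move=> /set1P oG /set1P fG; rewrite oG fG eqxx in fo.
Qed.

(** The [face_next] orbit has length 3, and each step is a value of [rotation]; closing up after
    three steps fixes the rotation at all three corners. *)
Lemma interior_face3 G f a b : connected_plane G -> interior_triangulated G ->
  f \in interior_faces G -> (a, b) \in f ->
  exists c, [/\ f = [set (a, b); (b, c); (c, a)],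
    [/\ adj G a b, adj G b c & adj G c a]
    & [/\ rotation G b a = c, rotation G c b = a & rotation G a c = b]].
Proof.
move=> [sG rG _ oG _] tG fG abf.
have f3 : #|f| = 3 by move: fG; rewrite 2!inE => /andP[fo fF]; apply: tG.
have fE : f = face_of G (a, b).
  by case/setD1P: fG => _ /faces_face_of; apply.
(* [face_next] sends darts to darts, so adjacency propagates along the orbit from a dart that
   generates [f]. *)
have ab : adj G a b.
  have [x xG fx] := interior_faceP oG fG.
  have : (a, b) \in face_of G x by rewrite -fx.
  rewrite inE -mem_darts => /connectP[p].
  elim: p x xG {fx} => [|y p IHp] x xG /=; first by move=> _ ->.
  case/andP=> /eqP <-; apply: IHp; case: x xG => u v.
  by rewrite mem_darts adjC => /(rotation_adj rG); rewrite inE.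
set c := rotation G b a; exists c.
have bc : adj G b c by apply: rotation_adj => //; rewrite adjC.
have or3 : fingraph.order (face_next G) (a, b) = 3.
  by rewrite -f3 fE /fingraph.order; apply: eq_card => y; rewrite !inE.
have := iter_order (@face_next_inj G) (a, b).
rewrite or3 /= /face_next /= -/c => -[ca acb].
rewrite ca in acb.
have cadj : adj G c a by rewrite -ca; apply: rotation_adj => //; rewrite adjC.
split=> //.
apply/setP => y; rewrite fE inE fconnect_orbit /fingraph.orbit or3 /=.
by rewrite !inE /face_next /= -/c ca -!orbA.
Qed.

Lemma face_vertices3 a b c :
  face_vertices [set (a, b); (b, c); (c, a)] = [set a; b; c].
Proof. by rewrite /face_vertices !imsetU !imset_set1. Qed.

Lemma interior_face_triangle G f :
  connected_plane G -> interior_triangulated G ->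
  f \in interior_faces G -> face_vertices f \in triangles G.
Proof.
move=> pG tG fG; have [_ _ _ oG _] := pG.
have [[a b] _ fE] := interior_faceP oG fG.
have abf : (a, b) \in f by rewrite fE face_of_refl.
have [c [-> [ab bc ca] _]] := interior_face3 pG tG fG abf.
by rewrite face_vertices3; apply/trianglesP; exists a, b, c.
Qed.

(** Serves to show that a vertex whose rotation swaps two neighbours has no others. *)
Lemma porbit_swap (s : {perm V}) b c v :
  s b = c -> s c = b -> v \in porbit s b -> (v == b) || (v == c).
Proof.
move=> sb sc /porbitP[i ->]; rewrite permX.
by elim: i => [|i IHi] /=; rewrite ?eqxx //;
   case/orP: IHi => /eqP->; rewrite ?sb ?sc eqxx ?orbT.
Qed.

(* Two interior triangles with the same vertices and opposite orientations fill
   up the rotation at each vertex, leaving no dart for the outer face. *)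
Lemma face_vertices_inj G : connected_plane G -> interior_triangulated G ->
  {in interior_faces G &, injective face_vertices}.
Proof.
move=> pG tG f g fG gG efg; have [sG rG cG oG _] := pG.
have /setD1P[nfo fF] := fG; have /setD1P[ngo gF] := gG.
have [[a b] _ fE] := interior_faceP oG fG.
have abf : (a, b) \in f by rewrite fE face_of_refl.
have [c [fE3 [ab bc ca] [rb rc ra]]] := interior_face3 pG tG fG abf.
have gV : face_vertices g = [set a; b; c] by rewrite -efg fE3 face_vertices3.
have : a \in face_vertices g by rewrite gV !inE eqxx.
case/imsetP=> [[a' y] ayg /= ea]; subst a'.
have [d [gE3 [ay yd da] [ry rd ra']]] := interior_face3 pG tG gG ayg.
have : y \in face_vertices g by rewrite gE3 face_vertices3 !inE eqxx orbT.
rewrite gV !inE eq_sym (negPf (adj_neq sG ay)) /=.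
(* If [y = b], the faces share the dart [(a, b)] and coincide. Otherwise [y = c], and [g] runs
   around the triangle the other way. *)
case/orP=> /eqP ey; rewrite {y}ey in ayg gE3 ay yd ry rd ra' *.
  by rewrite (faces_face_of fF abf) (faces_face_of gF ayg).
have : d \in face_vertices g by rewrite gE3 face_vertices3 !inE eqxx !orbT.
rewrite gV !inE (negPf (adj_neq sG da)) /= orbC.
rewrite eq_sym (negPf (adj_neq sG yd)) /= => /eqP ed.
rewrite {d}ed in gE3 yd da ry rd ra' *.
have nbr u v w z : rotation G u v = w -> rotation G u w = v -> adj G u v ->
    adj G u z -> (z == v) || (z == w).
  move=> r1 r2 uv uz; apply: (porbit_swap r1 r2).
  by have [_ orb] := rG u; apply: orb.
have na z := @nbr a b c z ra' ra ab.
have nb z := @nbr b c a z rd rb bc.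
have nc z := @nbr c a b z ry rc ca.
(* The set of the three corners is closed under adjacency, hence is everything by connectedness. *)
have all_abc v : v \in [set a; b; c].
  have /connectP[p] := cG a v.
  have : a \in [set a; b; c] by rewrite !inE eqxx.
  elim: p {1 3 4}a => [|w p IHp] u uabc /=; first by move=> _ ->.
  case/andP=> uw; apply: IHp; move: uabc uw; rewrite !inE -!orbA.
  case/or3P=> /eqP->.
  - by case/na/orP=> ->; rewrite ?orbT.
  - by case/nb/orP=> ->; rewrite ?orbT.
  - by case/nc/orP=> ->; rewrite ?orbT.
have dfg x : x \in darts G -> (x \in f) || (x \in g).
  case: x => u v; rewrite mem_darts fE3 gE3.
  have := all_abc u; rewrite !inE -!orbA.
  case/or3P=> /eqP->.
  - by case/na/orP=> /eqP->; rewrite ?eqxx ?orbT.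
  - by case/nb/orP=> /eqP->; rewrite ?eqxx ?orbT.
  - by case/nc/orP=> /eqP->; rewrite ?eqxx ?orbT.
(* Since darts exist, the exterior face is a genuine orbit and not the empty face of the one-vertex
   graph. *)
have : exists x, (x \in darts G) && (x \in outer G).
  move: (oG); rewrite {1}/faces ifF; last first.
    by apply/eqP => d0; have := mem_darts G a b; rewrite d0 inE ab.
  by case/imsetP=> x xG ->; exists x; rewrite xG face_of_refl.
case=> x /andP[/dfg/orP[xf|xg] xo].
- by rewrite (faces_face_of fF xf) (faces_face_of oG xo) eqxx in nfo.
- by rewrite (faces_face_of gF xg) (faces_face_of oG xo) eqxx in ngo.
Qed.

Lemma card_interior_faces G : connected_plane G ->
  (#|V| + #|interior_faces G| = #|edges G| + 1)%N.
Proof.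
move=> [_ _ _ oG eG]; have := cardsD1 (outer G) (faces G); rewrite oG => cG.
by move: eG; rewrite cG addnS addnA addn1 !addnS addn0 /interior_faces => -[].
Qed.

End PlaneGraphTheory.

(** * Quadrants of a rectangle at a point, and Helly's theorem for rectangles *)

Section FloorplanTheory.
Variable R : realType.
Local Open Scope ring_scope.
Implicit Types (A B C : rect R) (z p q : R * R).

(* The quadrants at [z], named by the signs of their two directions ([true] for
   increasing), in which [B] occupies a neighbourhood of [z]. *)
Definition quadrants B z : {set bool * bool} :=
  [set s | (if s.1 then z.1 < xmax B else xmin B < z.1) &&
           (if s.2 then z.2 < ymax B else ymin B < z.2)].

Lemma quadrants_overlap A B z s : in_rect A z -> in_rect B z ->
  s \in quadrants A z -> s \in quadrants B z ->
  exists w, in_interior A w && in_interior B w.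
Proof.
have side l m l' m' (t : R) (b : bool) :
    l <= t <= m -> l' <= t <= m' -> (if b then t < m else l < t) ->
    (if b then t < m' else l' < t) -> exists w, (l < w < m) && (l' < w < m').
  move=> /andP[lt tm] /andP[lt' tm'].
  case: b => /= h h'.
    (* Halfway from [t] to the nearer of the two ends in the chosen direction. *)
    exists ((t + Num.min m m') / 2).
    have [mm|mm] := leP m m'; apply/andP; split; apply/andP; split; lra.
  exists ((t + Num.max l l') / 2).
  have [mm|mm] := leP l l'; apply/andP; split; apply/andP; split; lra.
move=> /andP[zA1 zA2] /andP[zB1 zB2]; rewrite !inE.
move=> /andP[sA1 sA2] /andP[sB1 sB2].
have [w1 /andP[wA1 wB1]] := side _ _ _ _ _ _ zA1 zB1 sA1 sB1.
have [w2 /andP[wA2 wB2]] := side _ _ _ _ _ _ zA2 zB2 sA2 sB2.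
by exists (w1, w2); rewrite /in_interior /= wA1 wA2 wB1 wB2.
Qed.

Lemma quadrants_gt0 B z : in_rect B z -> (0 < #|quadrants B z|)%N.
Proof.
move=> /andP[/andP[x1 x2] /andP[y1 y2]]; apply/card_gt0P.
(* In each coordinate, go up unless [z] is at the upper end; there the positive side length leaves
   room below. *)
exists (z.1 < xmax B, z.2 < ymax B); rewrite inE /=.
have := rect_width B; have := rect_height B.
by case: (ltP z.1 (xmax B)) => hx; case: (ltP z.2 (ymax B)) => hy bh bw;
  apply/andP; split=> //=; lra.
Qed.

(** In a coordinate where [p] and [q] differ, [z] is strictly between the walls and both directions
    are free; the other coordinate always offers one. *)
Lemma in_rect_segment B p q z : in_rect B p -> in_rect B q ->
  p != q -> in_segment p q z -> z != p -> z != q -> (1 < #|quadrants B z|)%N.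
Proof.
case: p q => p1 p2 [q1 q2] /andP[/= p1B p2B] /andP[/= q1B q2B] pq.
move=> [t t01 zE] zp zq.
have t0 : t != 0.
  by apply: contraNneq zp => tz; rewrite zE tz /= !mul0r !addr0.
have t1 : t != 1.
  by apply: contraNneq zq => t1; rewrite zE t1 /= !mul1r !subrKC.
have /andP[t_gt0 t_lt1] : 0 < t < 1.
  by case/andP: t01 => h1 h2; rewrite !lt_neqAle h1 h2 t1 eq_sym t0.
have between l m a b : l <= a <= m -> l <= b <= m -> l < m ->
   let w := a + t * (b - a) in
   (w < m) || (l < w) /\ (a != b -> (w < m) && (l < w)).
  move=> /andP[la am] /andP[lb bm] lm w.
  have h1 : 0 <= t * (m - b) by apply: mulr_ge0; lra.
  have h2 : 0 <= (1 - t) * (m - a) by apply: mulr_ge0; lra.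
  have h3 : 0 <= t * (b - l) by apply: mulr_ge0; lra.
  have h4 : 0 <= (1 - t) * (a - l) by apply: mulr_ge0; lra.
  split; first by rewrite /w; apply/orP; case: (ltP (a + t * (b - a)) m) => h;
    [left|right]; lra.
  rewrite neq_lt => /orP[ab|ba]; rewrite /w.
    have h5 : 0 < t * (b - a) by apply: mulr_gt0; lra.
    have h6 : 0 < (1 - t) * (b - a) by apply: mulr_gt0; lra.
    by apply/andP; split; lra.
  have h5 : 0 < t * (a - b) by apply: mulr_gt0; lra.
  have h6 : 0 < (1 - t) * (a - b) by apply: mulr_gt0; lra.
  by apply/andP; split; lra.
have [/= X Xs] := between _ _ _ _ p1B q1B (rect_width B).
have [/= Y Ys] := between _ _ _ _ p2B q2B (rect_height B).
rewrite {}zE /= in zp zq *.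
set w1 := p1 + _ in X Xs *; set w2 := p2 + _ in Y Ys *.
apply/card_gt1P.
have : (p1 != q1) || (p2 != q2).
  by move: pq; rewrite -negb_and; apply: contra => /andP[/eqP-> /eqP->].
case/orP=> [/Xs|/Ys] /andP[h1 h2].
  by case/orP: Y => h; [exists (true, true), (false, true)
    | exists (true, false), (false, false)]; rewrite !inE /= ?h1 ?h2 ?h.
by case/orP: X => h; [exists (true, true), (true, false)
  | exists (false, true), (false, false)]; rewrite !inE /= ?h1 ?h2 ?h.
Qed.

(** The quadrants are the product of the free directions in each coordinate; on the boundary, one
    factor has lost a direction. *)
Lemma quadrants_boundary B z : on_boundary B z -> (#|quadrants B z| <= 2)%N.
Proof.
case/andP=> _ nz.
pose l1 := xmin B < z.1; pose m1 := z.1 < xmax B.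
pose l2 := ymin B < z.2; pose m2 := z.2 < ymax B.
have -> : quadrants B z = setX [set s : bool | if s then m1 else l1]
                               [set s : bool | if s then m2 else l2].
  by apply/setP => -[s1 s2]; rewrite !inE.
have card2 (l m : bool) : #|[set s : bool | if s then m else l]| = (l + m)%N.
  by rewrite -sum1_card big_mkcond big_bool !inE; case: l; case: m.
rewrite cardsX !card2; move: nz; rewrite /in_interior -/l1 -/m1 -/l2 -/m2.
by case: l1; case: m1; case: l2; case: m2.
Qed.

Lemma helly_interval (l1 m1 l2 m2 l3 m3 x12 x23 x31 : R) :
  l1 <= x12 <= m1 -> l2 <= x12 <= m2 -> l2 <= x23 <= m2 -> l3 <= x23 <= m3 ->
  l3 <= x31 <= m3 -> l1 <= x31 <= m1 ->
  exists t, [/\ l1 <= t <= m1, l2 <= t <= m2 & l3 <= t <= m3].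
Proof.
move=> /andP[? ?] /andP[? ?] /andP[? ?] /andP[? ?] /andP[? ?] /andP[? ?].
(* The largest left end is at most every right end, because any two of the intervals meet. *)
by exists (Num.max l1 (Num.max l2 l3)); split;
  rewrite !le_max !ge_max lexx ?orbT /=; repeat (apply/andP; split); lra.
Qed.

Lemma helly_rect A B C z1 z2 z3 :
  in_rect A z1 && in_rect B z1 -> in_rect B z2 && in_rect C z2 ->
  in_rect C z3 && in_rect A z3 ->
  exists z, [/\ in_rect A z, in_rect B z & in_rect C z].
Proof.
move=> /andP[/andP[A1 A1'] /andP[B1 B1']] /andP[/andP[B2 B2'] /andP[C2 C2']].
move=> /andP[/andP[C3 C3'] /andP[A3 A3']].
have [s [sA sB sC]] := helly_interval A1 B1 B2 C2 C3 A3.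
have [t [tA tB tC]] := helly_interval A1' B1' B2' C2' C3' A3'.
by exists (s, t); rewrite /in_rect /= sA sB sC tA tB tC.
Qed.

Lemma in_segmentl p q : in_segment p q p.
Proof. by exists 0; rewrite ?lexx ?ler01 // !mul0r !addr0; case: p. Qed.

(** * 3-cliques in the dual of a floorplan *)

Section Dual.
Variables (V : finType) (G : plane_graph V) (B : rect R) (r : V -> rect R).
Implicit Types a b c u v : V.

Lemma quadrants_trivI u v z : rectangular_floorplan B r -> u != v ->
  in_rect (r u) z -> in_rect (r v) z ->
  [disjoint quadrants (r u) z & quadrants (r v) z].
Proof.
move=> [_ dr _] uv zu zv; rewrite disjoint_subset; apply/subsetP => s su.
rewrite inE; apply/negP => sv.
have [w hw] := quadrants_overlap zu zv su sv.
by have := dr _ _ w uv; rewrite hw.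
Qed.

(** Makes quadrant counts add up, so that the sum can be bounded by the quadrants available at
    [z]. *)
Lemma card_quadrants3 a b c z : rectangular_floorplan B r ->
  a != b -> b != c -> c != a ->
  in_rect (r a) z -> in_rect (r b) z -> in_rect (r c) z ->
  (#|quadrants (r a) z| + #|quadrants (r b) z| + #|quadrants (r c) z| =
   #|quadrants (r a) z :|: quadrants (r b) z :|: quadrants (r c) z|)%N.
Proof.
move=> fp ab bc ca za zb zc.
have dab := quadrants_trivI fp ab za zb.
have dbc := quadrants_trivI fp bc zb zc.
have dca := quadrants_trivI fp ca zc za.
rewrite !cardsU setIUl (disjoint_setI0 dab) (disjoint_setI0 dbc).
by rewrite setIC (disjoint_setI0 dca) setU0 cards0 !subn0.
Qed.

Lemma quadrants_sub v z : rectangular_floorplan B r -> in_rect (r v) z ->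
  quadrants (r v) z \subset quadrants B z.
Proof.
move=> [fp _ _] zv.
have inB w : in_rect (r v) w -> in_rect B w by move=> wv; apply/fp; exists v.
have [wv hv] := (rect_width (r v), rect_height (r v)).
(* Two opposite corners of [r v] lie in [B], which places all walls of [r v] within those of [B]. *)
have /andP[/= /andP[l1 _] /andP[l2 _]] : in_rect B (xmin (r v), ymin (r v)).
  by apply: inB; rewrite /in_rect /= !lexx !ltW.
have /andP[/= /andP[_ m1] /andP[_ m2]] : in_rect B (xmax (r v), ymax (r v)).
  by apply: inB; rewrite /in_rect /= !lexx !ltW.
apply/subsetP => -[s t]; rewrite !inE /= => /andP[hs ht].
by apply/andP; split; [case: s hs|case: t ht]; lra.
Qed.

(* Disjointness leaves room for only four quadrants at the point common to a
   3-clique, and for only two on the boundary of the enclosure; a rectangle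
   having the point strictly inside one of its walls takes up two. *)
Lemma triangle_interior_face : connected_plane G -> interior_triangulated G ->
  rectangular_floorplan B r -> realizes_dual G B r ->
  triangles G \subset [set face_vertices f | f in interior_faces G].
Proof.
move=> pG tG fp [pos [posF posO posW _]]; have [sG _ _ oG _] := pG.
apply/subsetP => _ /trianglesP[a [b [c [ab bc ca ->]]]].
have [[nab nbc] nca] := (adj_neq sG ab, adj_neq sG bc, adj_neq sG ca).
have posin u v : adj G u v ->
    in_rect (r u) (pos (u, v)) && in_rect (r v) (pos (u, v)).
  by move=> uv; apply/(proj2 (posW _ _ uv)); exact: in_segmentl.
have [z [za zb zc]] := helly_rect (posin _ _ ab) (posin _ _ bc) (posin _ _ ca).
have q3 := card_quadrants3 fp nab nbc nca za zb zc.
have [[a0 b0] c0] := (quadrants_gt0 za, quadrants_gt0 zb, quadrants_gt0 zc).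
(* Three disjoint nonempty sets of quadrants do not fit into the two left by the boundary. *)
have zB : ~~ on_boundary B z.
  apply/negP => /quadrants_boundary; apply/negP; rewrite -ltnNge.
  apply: (@leq_trans (1 + 1 + 1)) => //.
  apply: (@leq_trans _ _ _ (leq_add (leq_add a0 b0) c0)).
  by rewrite q3 subset_leq_card // !subUset !quadrants_sub.
(* Otherwise [z] is strictly inside the wall of [a] and [b], and at least 2 + 2 + 1 quadrants would
   be taken out of 4. *)
have zends : (z == pos (a, b)) || (z == pos (b, a)).
  apply/negPn; rewrite negb_or; apply/negP => /andP[n1 n2].
  have [npq wall] := posW _ _ ab.
  have zseg : in_segment (pos (a, b)) (pos (b, a)) z.
    by apply/wall; rewrite za zb.
  have /andP[pa pb] := posin _ _ ab.
  have /andP[qb qa] : in_rect (r b) (pos (b, a)) && in_rect (r a) (pos (b, a)).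
    by apply: posin; rewrite adjC.
  have a1 := in_rect_segment pa qa npq zseg n1 n2.
  have b1 := in_rect_segment pb qb npq zseg n1 n2.
  have := leq_add (leq_add a1 b1) c0; rewrite q3 => h.
  have := leq_trans h (max_card _).
  by rewrite card_prod card_bool.
have z3 d : in_rect (r d) z -> d \in [set a; b; c].
  move=> zd; have [_ _ /(_ z) le3] := fp.
  have sub : [set a; b; c] \subset [set v | in_rect (r v) z].
    by rewrite !subUset !sub1set !inE za zb zc.
  have c3 : #|[set a; b; c]| = 3.
    by rewrite setUC cardsU1 cards2 !inE nab (negPf nca) eq_sym (negPf nbc).
  have /eqP -> : [set a; b; c] == [set v | in_rect (r v) z].
    by rewrite eqEcard sub c3.
  by rewrite inE.
(* Either dart of the edge between [a] and [b] may be the one positioned at [z]. *)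
suff face u v : adj G u v -> pos (u, v) = z -> [set u; v] = [set a; b] ->
    [set a; b; c] \in [set face_vertices f | f in interior_faces G].
  case/orP: zends => /eqP zE; first exact: (face a b).
  by apply: (face b a); rewrite 1?adjC 1?setUC.
move=> uv zE uvE.
have uvD : (u, v) \in darts G by rewrite mem_darts.
have no : (u, v) \notin outer G by apply: contra zB => /posO; rewrite zE.
have fG : face_of G (u, v) \in interior_faces G by rewrite face_of_interior.
have [d [fE [_ vd du] _]] := interior_face3 pG tG fG (face_of_refl G (u, v)).
apply/imsetP; exists (face_of G (u, v)) => //.
rewrite fE face_vertices3 uvE; suff -> : d = c by [].
have vdf : (v, d) \in face_of G (u, v) by rewrite fE !inE eqxx orbT.
(* All darts of an interior face share one position, so [z] is also an end of the wall between [r v]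
   and [r d]. *)
have zd : in_rect (r d) z.
  by rewrite -zE (posF _ _ uvD no vdf); have /andP[] := posin _ _ vd.
have := z3 d zd; rewrite -uvE !inE eq_sym.
rewrite eq_sym (negPf (adj_neq sG du)) eq_sym (negPf (adj_neq sG vd)).
by move/eqP.
Qed.

End Dual.

End FloorplanTheory.

(** * Counting 3-cliques against interior faces *)

Theorem theorem5p1 (R : realType) (V : finType) (G G' : plane_graph V)
    (vi vj : V) :
  edge_reducible_to R G G' ->
  [set vi; vj] \notin edges G' ->
  edges G = edges G' :|: [set [set vi; vj]] ->
  exterior_edge G vi vj.
Proof.
move=> [[pG tG [B [r [fp dual]]]] [pG' tG' _] _] nij eE.
have [sG _ _ oG _] := pG.
have ij : adj G vi vj by rewrite /adj eE !inE eqxx orbT.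
have [ijD jiD] : (vi, vj) \in darts G /\ (vj, vi) \in darts G.
  by split; rewrite mem_darts // adjC.
rewrite /exterior_edge ij /=; apply/negPn; rewrite negb_or.
rewrite -(face_of_interior oG ijD) -(face_of_interior oG jiD).
apply/negP => /andP[fG gG].
set f := face_of G (vi, vj) in fG; set g := face_of G (vj, vi) in gG.
have [c [fE [_ vjc cvi] _]] := interior_face3 pG tG fG (face_of_refl G _).
(* A triangular face never contains both darts of an edge. *)
have fg : f != g.
  apply/eqP => fg; have := face_of_refl G (vj, vi); rewrite -/g -fg fE !inE.
  rewrite !xpair_eqE [vj == vi]eq_sym [vi == c]eq_sym (negPf (adj_neq sG ij)).
  by rewrite (negPf (adj_neq sG cvi)) (negPf (adj_neq sG vjc)) !andbF.
have inj := face_vertices_inj pG tG; have inj' := face_vertices_inj pG' tG'.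
have triG := triangle_interior_face pG tG fp dual.
have fgV : face_vertices f != face_vertices g by rewrite (inj_in_eq inj).
have triE t : t \in triangles G' ->
    (t \in triangles G) && ~~ ((vi \in t) && (vj \in t)).
  move=> tT; apply/andP; split; last first.
    apply/negP => /andP[ti tj]; move/negP: nij; apply.
    exact: triangle_adj tT ti tj (adj_neq sG ij).
  case/trianglesP: tT => [a [b' [c' [ab bc ca ->]]]]; apply/trianglesP.
  by exists a, b', c'; split=> //; rewrite /adj eE inE ?(ab, bc, ca) //;
    apply/orP; left.
have fgt h : h \in interior_faces G -> (vi, vj) \in h \/ (vj, vi) \in h ->
    (face_vertices h \in triangles G) && (vi \in face_vertices h)
      && (vj \in face_vertices h).
  move=> hG hij; rewrite interior_face_triangle //=.
  case: hij => /(interior_face3 pG tG hG)[d [-> _ _]];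
  by rewrite face_vertices3 !inE !eqxx ?orbT.
have /andP[/andP[fT fi] fj] := fgt f fG (or_introl (face_of_refl G _)).
have /andP[/andP[gT gi] gj] := fgt g gG (or_intror (face_of_refl G _)).
(* Both removed cliques contain [vi] and [vj], which are not adjacent in [G']. *)
have sub : triangles G' \subset
    triangles G :\ face_vertices f :\ face_vertices g.
  apply/subsetP => t /triE/andP[tGG]; rewrite !inE tGG andbT => nt.
  by apply/andP; split; apply: contraNneq nt => ->; rewrite ?(gi, gj, fi, fj).
have lt2 : #|triangles G'| + 2 <= #|triangles G|.
  rewrite (cardsD1 (face_vertices f) (triangles G)) fT.
  rewrite (cardsD1 (face_vertices g) (_ :\ _)).
  by rewrite 2!inE eq_sym fgV gT addnA addnC leq_add2l subset_leq_card.
have le1 : #|triangles G| <= #|interior_faces G|.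
  by exact: leq_trans (subset_leq_card triG) (leq_imset_card _ _).
have le2 : #|interior_faces G'| <= #|triangles G'|.
  rewrite -(card_in_imset inj'); apply: subset_leq_card.
  by apply/subsetP => _ /imsetP[h hG ->]; apply: interior_face_triangle.
have cE : #|edges G| = #|edges G'|.+1 by rewrite eE setUC cardsU1 nij.
have eqF : #|interior_faces G| = #|interior_faces G'|.+1.
  apply: (@addnI #|V|); rewrite addnS (card_interior_faces pG).
  by rewrite (card_interior_faces pG') cE addSn.
(* The clique count drops by at least 2 and the face count by 1, which would leave [G'] with fewer
   3-cliques than interior faces. *)
have := leq_trans lt2 le1; rewrite eqF addn2 ltnS leqNgt.
by rewrite ltnS le2.
Qed.
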